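(* For two compact non-Archimedean metric spaces $(X,\widehat{d}_X)$ and $(Y,\widehat{d}_Y)$, $$\widehat{d}_{GH}(X,Y)=\inf\{\varepsilon>0 : X \text{ and } Y \text{ are strong } \varepsilon\text{-approximations of each other}\}.$$
   Context: A non-Archimedean metric space $(X,\widehat{d}_X)$ is a set with a metric satisfying the strong triangle inequality $\widehat{d}_X(x,z)\le\max\{\widehat{d}_X(x,y),\widehat{d}_X(y,z)\}$. The non-Archimedean Gromov-Hausdorff distance is $\widehat{d}_{GH}(X,Y)=\inf\{\widehat{d}_{H}(f(X),g(Y))\}$, the infimum being over all non-Archimedean metric spaces $(Z,\widehat{d}_Z)$ and all isometric embeddings $f:X\hookrightarrow Z$, $g:Y\hookrightarrow Z$, where $\widehat{d}_H$ is the Hausdorff distance between subsets of $Z$. A subset $S$ of a metric space $(X,d)$ is an $\varepsilon$-net if $\operatorname{dist}(x,S)=\inf_{s\in S}d(x,s)<\varepsilon$ for all $x\in X$. Two compact non-Archimedean metric spaces $X$ and $Y$ are strong $\varepsilon$-approximations of each other ($\varepsilon>0$) if there exist finite collections of points $\{x_i\}_{i=1}^N$ in $X$ and $\{y_i\}_{i=1}^N$ in $Y$ such that: (1) the set $\{x_i:1\le i\le N\}$ is an $\varepsilon$-net in $X$ and $\{y_i:1\le i\le N\}$ is an $\varepsilon$-net in $Y$; (2) $\widehat{d}_X(x_i,x_j)=\widehat{d}_Y(y_i,y_j)$ for all $i,j\in\{1,\dots,N\}$. *)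

(* Defs.v *)
From HB Require Import structures.
From mathcomp Require Import all_boot all_order all_algebra.
From mathcomp Require Import all_classical all_reals all_analysis.

Set Implicit Arguments.
Unset Strict Implicit.
Unset Printing Implicit Defensive.

Import Order.TTheory GRing.Theory Num.Theory.
Local Open Scope classical_set_scope.
Local Open Scope ring_scope.

(* All infima of distances below are taken in [\bar R], with [ereal_inf set0 =
   +oo]; hence no convention is needed for empty or unbounded sets, and empty
   spaces are allowed. *)

Definition non_archimedean (R : realType) (X : metricType R) : Prop :=
  forall x y z : X, mdist x z <= Num.max (mdist x y) (mdist y z).

Definition isometric_embedding (R : realType) (X Z : metricType R)
    (f : X -> Z) : Prop :=
  forall x y : X, mdist (f x) (f y) = mdist x y.

Definition dist_to (R : realType) (X : metricType R) (x : X) (S : set X) :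
    \bar R :=
  ereal_inf [set (mdist x s)%:E | s in S].

Definition eps_neighborhood (R : realType) (X : metricType R) (eps : R)
    (S : set X) : set X :=
  [set x | (dist_to x S < eps%:E)%E].

Definition hausdorff_dist (R : realType) (Z : metricType R) (A B : set Z) :
    \bar R :=
  ereal_inf [set r%:E | r in
    [set r : R | [/\ 0 < r, A `<=` eps_neighborhood r B
                         & B `<=` eps_neighborhood r A]]].

Definition non_archimedean_GH_dist (R : realType) (X Y : metricType R) :
    \bar R :=
  ereal_inf [set h : \bar R |
    exists (Z : metricType R) (f : X -> Z) (g : Y -> Z),
      [/\ non_archimedean Z, isometric_embedding f, isometric_embedding g
        & h = hausdorff_dist (range f) (range g)]].

Definition eps_net (R : realType) (X : metricType R) (eps : R) (S : set X) :
    Prop :=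
  forall x : X, (dist_to x S < eps%:E)%E.

Definition strong_approximations (R : realType) (X Y : metricType R)
    (eps : R) : Prop :=
  exists (N : nat) (x : 'I_N -> X) (y : 'I_N -> Y),
    [/\ eps_net eps (range x), eps_net eps (range y)
      & forall i j : 'I_N, mdist (x i) (x j) = mdist (y i) (y j)].

(* Main.v *)
(** For [r] in the set defining a Hausdorff distance, pick finitely many points
    of [X] at pairwise distances at least [r] that form an [r]-net, and for each
    one a point of [Y] at distance less than [r] in the ambient space; since all
    triangles are isosceles with a short base, moving the endpoints by less than
    [r] does not change distances that are at least [r].  Conversely, matching
    [eps]-nets give a map [p : X -> Y] which preserves distances larger than
    [eps], and [d (x, y) = max (eps, d (p x, y))] is an ultrametric on the
    disjoint union of [X] and [Y]. *)
Require Import Defs.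
From HB Require Import structures.
From mathcomp Require Import all_boot all_order all_algebra.
From mathcomp Require Import all_classical all_reals all_analysis.

Set Implicit Arguments.
Unset Strict Implicit.
Unset Printing Implicit Defensive.

Import Order.TTheory GRing.Theory Num.Theory.
Local Open Scope classical_set_scope.
Local Open Scope ring_scope.

Lemma dist_to_lt (R : realType) (X : metricType R) (x : X) (S : set X)
    (r : R) :
  (dist_to x S < r%:E)%E <-> exists2 s, S s & mdist x s < r.
Proof.
split=> [/ereal_inf_lt[_ [s Ss <-]]|[s Ss xs]].
  by rewrite lte_fin; exists s.
apply: (@le_lt_trans _ _ (mdist x s)%:E); last by rewrite lte_fin.
by apply: ereal_inf_lbound; exists s.
Qed.

Lemma non_archimedean_le (R : realType) (X : metricType R) (e : R) (x y z : X) :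
  non_archimedean X -> mdist x y <= e -> mdist y z <= e -> mdist x z <= e.
Proof. by move=> na xy yz; apply: le_trans (na x y z) _; rewrite ge_max xy. Qed.

Lemma non_archimedean_lt (R : realType) (X : metricType R) (e : R) (x y z : X) :
  non_archimedean X -> mdist x y < e -> mdist y z < e -> mdist x z < e.
Proof.
by move=> na xy yz; apply: le_lt_trans (na x y z) _; rewrite gt_max xy.
Qed.

(** Finitely many [r]-balls cover [X]. Running through their centres and keeping only those at
    distance at least [r] from all centres kept so far gives [t]; the net radius stays [r] because
    the strong triangle inequality does not add errors. *)
Lemma compact_separated_net (R : realType) (X : metricType R) (r : R) :
    compact [set: X] -> non_archimedean X -> 0 < r ->
  exists t : seq X, {in t &, forall x y, mdist x y < r -> x = y} /\
    forall x, exists2 z, z \in t & mdist x z < r.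
Proof.
move=> cX na r0.
have [[x0 _]|X0] := pselect ([set: X] !=set0); last first.
  by exists [::]; split=> // x; case: X0; exists x.
(* Only because [compact_cover] is stated for pointed spaces. *)
pose Xp : ptopologicalType := HB.pack_for ptopologicalType X
  (isPointed.Build X x0).
have [D _ Dcover] : finite_subset_cover
    [set: X] (fun x => (ball x r)°) [set: X].
  have := cX; rewrite -[compact _]/(compact [set: Xp]) compact_cover; apply.
  - by move=> x _; apply: (@open_interior X).
  - by move=> x _; exists x => //; apply: (@nbhsx_ballx _ X).
suff [t [tsep tnet]] : exists t : seq X,
    {in t &, forall x y, mdist x y < r -> x = y} /\
    {in finmap.enum_fset D, forall x, exists2 z, z \in t & mdist x z < r}.
  exists t; split=> // x; have [y /= yD /interior_subset] := Dcover x I.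
  rewrite ballEmdist /= metric_sym => xy.
  have [z zt yz] := tnet y yD; exists z => //.
  exact: non_archimedean_lt na xy yz.
elim: (finmap.enum_fset D) => [|a s [t [tsep tnet]]]; first by exists [::].
have [[z zt az]|far] := pselect (exists2 z, z \in t & mdist a z < r).
  exists t; split=> // x; rewrite inE => /predU1P[->|/tnet//].
  by exists z.
exists (a :: t); split=> [x y|x].
  rewrite !inE => /predU1P[->|xt] /predU1P[->|yt] //; last exact: tsep.
  - by move=> ay; case: far; exists y.
  - by rewrite metric_sym => ax; case: far; exists x.
rewrite inE => /predU1P[->|/tnet[z zt xz]].
  by exists a; rewrite ?mem_head// mdistxx.
by exists z; rewrite // inE zt orbT.
Qed.

Lemma strong_approximations_of_hausdorff (R : realType)
    (X Y Z : metricType R) (f : X -> Z) (g : Y -> Z) (r : R) :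
    compact [set: X] -> non_archimedean X -> non_archimedean Z ->
    isometric_embedding f -> isometric_embedding g -> 0 < r ->
    range f `<=` eps_neighborhood r (range g) ->
    range g `<=` eps_neighborhood r (range f) ->
  strong_approximations X Y r.
Proof.
move=> cX naX naZ fi gi r0 fg gf.
have [t [tsep tnet]] := compact_separated_net cX naX r0.
have /choice[h hP] : forall x, exists y, mdist (f x) (g y) < r.
  move=> x; have /dist_to_lt[_ [y _ <-] xy] := fg _ (imageT f x).
  by exists y.
have hP' x : mdist (g (h x)) (f x) < r by rewrite metric_sym.
pose x (i : 'I_(size t)) := tnth (in_tuple t) i.
have xE z : z \in t -> exists i, x i = z.
  by move=> /(tnthP (in_tuple t))[i ->]; exists i.
have xt i : x i \in t by apply: (mem_tnth i (in_tuple t)).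
exists (size t), x, (h \o x); split.
- move=> u; apply/dist_to_lt; have [z /xE[i <-] uz] := tnet u.
  by exists (x i).
- move=> y; apply/dist_to_lt.
  have /dist_to_lt[_ [u _ <-] yu] := gf _ (imageT g y).
  have [z /xE[i <-] uz] := tnet u.
  (* The path [g y], [f u], [f (x i)], [g (h (x i))] in [Z] has all its steps shorter than [r]. *)
  exists (h (x i)); first by exists i.
  rewrite -gi; apply: (non_archimedean_lt naZ yu).
  by apply: (non_archimedean_lt naZ _ (hP _)); rewrite fi.
- move=> i j /=; have [xij|] := ltP (mdist (x i) (x j)) r.
    by rewrite (tsep _ _ (xt i) (xt j) xij) !mdistxx.
  rewrite -fi -gi => rij; apply/eqP; rewrite eq_le; apply/andP; split.
    (* Were the distance between the images under [g] smaller, the path through them from [f (x i)]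
       to [f (x j)] would have all steps shorter than the distance of its ends. *)
    rewrite leNgt; apply/negP => ltij; move: (lexx (mdist (f (x i)) (f (x j)))).
    apply/negP; rewrite -ltNge.
    apply: (non_archimedean_lt naZ (lt_le_trans (hP _) rij)).
    exact: (non_archimedean_lt naZ ltij (lt_le_trans (hP' _) rij)).
  apply: (non_archimedean_le naZ (ltW (lt_le_trans (hP' _) rij))).
  exact: (non_archimedean_le naZ _ (ltW (lt_le_trans (hP _) rij))).
Qed.

(** Quantifying over a common bound [e] expresses the strong triangle inequality without maxima,
    which suits a [d] defined by cases. *)
Lemma ultrametric_metricType (R : realType) (T : choiceType) (d : T -> T -> R) :
    (forall x, d x x = 0) -> (forall x y, d x y = 0 -> x = y) ->
    (forall x y, d x y = d y x) ->
    (forall x y z e, d x y <= e -> d y z <= e -> d x z <= e) ->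
  exists (Z : metricType R) (h : T -> Z),
    non_archimedean Z /\ forall x y, mdist (h x) (h y) = d x y.
Proof.
(* [isMetric.Build] needs a choice structure in constructor form. *)
case: T d => T [cT eT] d d0 dpos dC dna.
pose T' : choiceType := Choice.Pack (Choice.Class cT eT).
have dge0 x y : 0 <= d x y.
  by rewrite -(d0 x); apply: (dna x y x) => //; rewrite dC.
have dtri y x z : d x z <= d x y + d y z.
  by apply: (dna x y z); rewrite (lerDl, lerDr).
pose dmetric := isMetric.Build R T' d0 dpos dC dtri.
pose Z : metricType R := HB.pack_for (metricType R) T cT eT dmetric.
exists Z, id; split=> // x y z.
by apply: (dna x y z); rewrite le_max lexx ?orbT.
Qed.

Lemma GH_dist_le (R : realType) (X Y : metricType R) (eps : R) (p : X -> Y) :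
    non_archimedean X -> non_archimedean Y -> 0 < eps ->
    (forall x x' e, eps <= e ->
       (mdist (p x) (p x') <= e) = (mdist x x' <= e)) ->
    (forall y, exists x, mdist (p x) y <= eps) ->
  (non_archimedean_GH_dist X Y <= eps%:E)%E.
Proof.
move=> naX naY eps0 pP psurj.
(* The maximum with [eps > 0] keeps the two copies apart and puts each [x] at distance exactly [eps]
   from [p x]. *)
pose cross x y := Num.max eps (mdist (p x) y).
pose d (u v : X + Y) : R := match u, v with
  | inl x, inl x' => mdist x x'
  | inr y, inr y' => mdist y y'
  | inl x, inr y | inr y, inl x => cross x y
  end.
have cross_neq0 x y : cross x y <> 0.
  by apply/eqP; rewrite gt_eqF// lt_max eps0.
have [|||| Z [h [naZ hd]]] := @ultrametric_metricType R _ d.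
- by case=> x; apply: mdistxx.
- by move=> [x|x] [y|y] //= => [/mdist_positivity->|/cross_neq0|/cross_neq0
    |/mdist_positivity->].
- by move=> [x|x] [y|y] //=; apply: metric_sym.
(* In the six mixed cases a bound on a cross distance gives [eps <= e], so [pP] applies and the
   triangle can be moved into [Y]. *)
- move=> [x|x] [y|y] [z|z] e //=; rewrite /cross ?ge_max.
  + exact: non_archimedean_le.
  + move=> xy /andP[ee yz]; rewrite ee /=.
    by apply: non_archimedean_le yz; rewrite // pP.
  + move=> /andP[ee xy] /andP[_ zy]; rewrite -pP//.
    by apply: non_archimedean_le xy _; rewrite // metric_sym.
  + move=> /andP[ee xy] yz; rewrite ee /=.
    exact: non_archimedean_le xy yz.
  + move=> /andP[ee yx] yz; rewrite ee /=.
    by apply: non_archimedean_le yx; rewrite // pP// metric_sym.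
  + move=> /andP[ee yx] /andP[_ yz].
    by apply: non_archimedean_le yz; rewrite // metric_sym.
  + move=> xy /andP[ee zy]; rewrite ee /=.
    by apply: non_archimedean_le zy _; rewrite // metric_sym.
  + exact: non_archimedean_le.
(* Neighbourhoods are strict while the distance [eps] is attained, hence the slack [e]. *)
apply/lee_addgt0Pr => e e0; rewrite -EFinD.
have epse : eps < eps + e by rewrite ltrDl.
apply: ge_ereal_inf.
exists (hausdorff_dist (range (h \o inl)) (range (h \o inr))).
  by exists Z, (h \o inl), (h \o inr); split=> // x y; rewrite /= hd.
apply: ereal_inf_lbound; exists (eps + e) => //; split.
- exact: lt_trans epse.
- move=> _ [x _ <-]; apply/dist_to_lt.
  exists (h (inr (p x))); first by exists (p x).
  by rewrite hd /= /cross mdistxx max_l// ltW.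
- move=> _ [y _ <-]; apply/dist_to_lt; have [x xy] := psurj y.
  by exists (h (inl x)); [exists x|rewrite hd /= /cross max_l].
Qed.

Theorem corollary3p7 (R : realType) (X Y : metricType R)
    (compactX : compact [set: X]) (naX : non_archimedean X)
    (compactY : compact [set: Y]) (naY : non_archimedean Y) :
  non_archimedean_GH_dist X Y =
  ereal_inf [set eps%:E | eps in
    [set eps : R | 0 < eps /\ strong_approximations X Y eps]].
Proof.
apply/eqP; rewrite eq_le; apply/andP; split; apply: le_ereal_inf_tmp.
  move=> _ [eps [eps0 [N [x [y [xnet ynet xy]]]]] <-].
  have /choice[i iP] : forall u, exists i, mdist u (x i) < eps.
    by move=> u; have /dist_to_lt[_ [i _ <-] ui] := xnet u; exists i.
  (* The map sends [u] to the partner in [Y] of a net point near [u]. *)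
  apply: (@GH_dist_le _ _ _ eps (y \o i)) => //.
    move=> u v e ee; rewrite /= -xy.
    have iP' w : mdist w (x (i w)) <= e by apply: ltW (lt_le_trans (iP w) ee).
    have iP'' w : mdist (x (i w)) w <= e by rewrite metric_sym.
    apply/idP/idP => uv.
      apply: (non_archimedean_le naX (iP' u)).
      exact: (non_archimedean_le naX uv (iP'' v)).
    apply: (non_archimedean_le naX (iP'' u)).
    exact: (non_archimedean_le naX uv (iP' v)).
  move=> v; have /dist_to_lt[_ [j _ <-] vj] := ynet v.
  (* The index [i (x j)] may differ from [j], but matching distances still put its partner within
     [eps] of [y j]. *)
  exists (x j) => /=; apply: (@non_archimedean_le _ _ _ _ (y j)) => //.
    by rewrite -xy metric_sym ltW.
  by rewrite metric_sym ltW.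
move=> _ [Z [f [g [naZ fi gi ->]]]]; apply: le_ereal_inf_tmp.
move=> _ [r [r0 fg gf] <-]; apply: ereal_inf_lbound; exists r => //; split=> //.
exact: (strong_approximations_of_hausdorff compactX naX naZ fi gi r0 fg gf).
Qed.
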